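(* For every rewb $\alpha\in\mathrm{REWB}$ over a finite alphabet $\Sigma$, there exists a one-way nondeterministic nested stack automaton $A_\alpha$ with $L(A_\alpha)=L(\alpha)$.
   Context: Fix a finite alphabet $\Sigma$. For $k\ge1$, $[k]=\{1,\dots,k\}$, $B_k=\{[_i,\,]_i:i\in[k]\}$ fresh brackets. $g$ is the homomorphism fixing letters of $\Sigma$ and erasing brackets. Rewbs: $\mathrm{REWB}_k$ and $\mathrm{var}(\alpha)$ defined inductively: $a\in\Sigma\cup\{\varepsilon\}$ ($\mathrm{var}=\emptyset$); $\backslash i$, $i\in[k]$ ($\mathrm{var}=\{i\}$); $\alpha_0\alpha_1$, $\alpha_0+\alpha_1$ (union of vars); $\alpha_0^\ast$; $(_j\alpha_0)_j$ for $j\in[k]\setminus\mathrm{var}(\alpha_0)$ (var gains $j$). Labels may be repeated on different captures. $\mathrm{REWB}_0$ is the set of ordinary regular expressions and $\mathrm{REWB}=\bigcup_{k\ge0}\mathrm{REWB}_k$. $\mathcal{R}_k(\alpha)$ is the regular language over $\Sigma\uplus B_k\uplus[k]$ obtained reading $\alpha$ as a regular expression with $\backslash i$ as the letter $i$ and $(_i\alpha_0)_i$ as $[_i\,\mathcal{R}_k(\alpha_0)\,]_i$. Dereferencing $\mathcal{D}_k$: repeatedly take the leftmost number $i\in[k]$ in the current string; if no $[_i$ lies to its left, delete this $i$; otherwise take the nearest $[_i$ to its left; if no $]_i$ lies between them the result is undefined; otherwise replace this $i$ by $g(u)$, $u$ the string strictly between that $[_i$ and the first $]_i$ after it; when no numbers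 remain, delete all brackets. $L(\alpha)=\{\mathcal{D}_k(v):v\in\mathcal{R}_k(\alpha)\}$ (for $k=0$, the usual regular language). Automata: a one-way nondeterministic stack automaton (SA) has finite states, a start state, final states, a one-way read-only input (each move reads the current input symbol and either leaves the cursor or advances it), and a stack over a finite alphabet $\Gamma$ with initial symbol $Z_0$, delimited by a bottom marker $\#$ and top marker $\$$. A stack pointer may move left/right within the stack and the machine reads the symbol under it (and can detect bottom/top); only when the pointer is on the top symbol $Z$ may it replace $Z$ by any $w\in\Gamma^\ast$ (pointer then at the new top). It accepts an input if some run consumes all of it and ends in a final state. A nested stack automaton (NSA, Aho 1969) additionally may, at any scanned stack position, create a new substack $¢\,w\,\$$ ($w\in\Gamma^\ast$) inserted just below the scanned symbol, with the pointer moved to the top of the new substack; thereafter the pointer may only move within the part of the stack from $\#$ up to the top of the innermost substack, pushing/popping is allowed only at that top, and an empty innermost substack $¢\$$ may be destroyed, after which the pointer is on the symbol just above where it was. *)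

(* Defs.v *)
From mathcomp Require Import all_boot.
From Stdlib Require List.

Set Implicit Arguments.
Unset Strict Implicit.
Unset Printing Implicit Defensive.

Inductive rewb (Sigma : Type) : Type :=
| RChar of Sigma
| REps
| RRef of nat
| RCat of rewb Sigma & rewb Sigma
| RUnion of rewb Sigma & rewb Sigma
| RStar of rewb Sigma
| RCap of nat & rewb Sigma.

Arguments REps {Sigma}.
Arguments RRef {Sigma}.

Fixpoint rvars (Sigma : Type) (a : rewb Sigma) : seq nat :=
  match a with
  | RChar _ | REps => [::]
  | RRef i => [:: i]
  | RCat a0 a1 | RUnion a0 a1 => rvars a0 ++ rvars a1
  | RStar a0 => rvars a0
  | RCap j a0 => j :: rvars a0
  end.

Fixpoint in_REWB (Sigma : Type) (k : nat) (a : rewb Sigma) : Prop :=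
  match a with
  | RChar _ | REps => True
  | RRef i => 1 <= i <= k
  | RCat a0 a1 | RUnion a0 a1 => in_REWB k a0 /\ in_REWB k a1
  | RStar a0 => in_REWB k a0
  | RCap j a0 => [/\ 1 <= j <= k, j \notin rvars a0 & in_REWB k a0]
  end.

Inductive sym (Sigma : Type) : Type :=
| SL of Sigma
| SOpen of nat
| SClose of nat
| SNum of nat.

Arguments SOpen {Sigma}.
Arguments SClose {Sigma}.
Arguments SNum {Sigma}.

Inductive inR (Sigma : Type) : rewb Sigma -> seq (sym Sigma) -> Prop :=
| inR_char a : inR (RChar a) [:: SL a]
| inR_eps : inR REps [::]
| inR_ref i : inR (RRef i) [:: SNum i]
| inR_cat a0 a1 u v : inR a0 u -> inR a1 v -> inR (RCat a0 a1) (u ++ v)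
| inR_unionl a0 a1 u : inR a0 u -> inR (RUnion a0 a1) u
| inR_unionr a0 a1 u : inR a1 u -> inR (RUnion a0 a1) u
| inR_star0 a0 : inR (RStar a0) [::]
| inR_starS a0 u v : inR a0 u -> inR (RStar a0) v -> inR (RStar a0) (u ++ v)
| inR_cap j a0 u : inR a0 u -> inR (RCap j a0) (SOpen j :: u ++ [:: SClose j]).

Definition isNum (Sigma : Type) (x : sym Sigma) : bool :=
  if x is SNum _ then true else false.
Definition isOpen (Sigma : Type) (i : nat) (x : sym Sigma) : bool :=
  if x is SOpen j then j == i else false.
Definition isClose (Sigma : Type) (i : nat) (x : sym Sigma) : bool :=
  if x is SClose j then j == i else false.

Definition gh (Sigma : Type) (w : seq (sym Sigma)) : seq Sigma :=
  flatten (map (fun x => if x is SL a then [:: a] else [::]) w).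

(* Dereferencing D_k as a (deterministic, partial) big-step relation:
   deref v r  <->  D_k(v) is defined and equals r. *)
Inductive deref (Sigma : Type) : seq (sym Sigma) -> seq Sigma -> Prop :=
| deref_done w :
    ~~ has (@isNum Sigma) w -> deref w (gh w)
| deref_del pre i post r :
    ~~ has (@isNum Sigma) pre ->
    ~~ has (isOpen i) pre ->
    deref (pre ++ post) r ->
    deref (pre ++ SNum i :: post) r
| deref_rep p1 u p3 i post r :
    (* the leftmost number is i; the nearest [_i to its left is followed
       by u ]_i with u containing no ]_i: replace i by g(u) *)
    ~~ has (@isNum Sigma) (p1 ++ SOpen i :: u ++ SClose i :: p3) ->
    ~~ has (isOpen i) (u ++ SClose i :: p3) ->
    ~~ has (isClose i) u ->
    deref (p1 ++ SOpen i :: u ++ SClose i :: p3 ++ map (@SL Sigma) (gh u) ++ post) r ->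
    deref (p1 ++ SOpen i :: u ++ SClose i :: p3 ++ SNum i :: post) r.

Definition rewb_lang (Sigma : Type) (a : rewb Sigma) (w : seq Sigma) : Prop :=
  exists v, inR a v /\ deref v w.

(* One-way nondeterministic nested stack automata (Aho 1969).          *)
(* The accessible part of the stack (from # to the $ of the innermost  *)
(* substack) is a flat list of cells; the parts of the stack lying     *)
(* above the innermost substack are kept in a list of saved suffixes.  *)

Inductive cell (Gam : Type) : Type :=
| CBot
| CTop
| CCent
| CG of Gam.

Arguments CBot {Gam}.
Arguments CTop {Gam}.
Arguments CCent {Gam}.

Inductive action (Gam : Type) : Type :=
| ALeft
| ARight
| AStay
| ARepl of seq Gam
| ACreate of seq Gam
| ADestroy.

Arguments ALeft {Gam}.
Arguments ARight {Gam}.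
Arguments AStay {Gam}.
Arguments ADestroy {Gam}.

Record nsa (Sigma : finType) : Type := NSA {
  nsa_state : finType;
  nsa_gam : finType;
  nsa_start : nsa_state;
  nsa_final : pred nsa_state;
  nsa_Z0 : nsa_gam;
  (* finitely many transitions
     (state, current input symbol or None at end of input, scanned cell,
      new state, advance input?, stack action) *)
  nsa_trans : seq (nsa_state * option Sigma * cell nsa_gam * nsa_state
                   * bool * action nsa_gam)
}.

Definition isG (Gam : Type) (c : cell Gam) : bool :=
  if c is CG _ then true else false.

Inductive act_sem (Gam : Type) :
  action Gam -> seq (cell Gam) -> seq (seq (cell Gam)) -> nat ->
  seq (cell Gam) -> seq (seq (cell Gam)) -> nat -> Prop :=
| as_left s sv p : 0 < p -> act_sem ALeft s sv p s sv p.-1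
| as_right s sv p : p.+1 < size s -> act_sem ARight s sv p s sv p.+1
| as_stay s sv p : act_sem AStay s sv p s sv p
| as_repl w s sv p :
    p.+2 = size s -> isG (nth CBot s p) ->
    act_sem (ARepl w) s sv p (take p s ++ map (@CG Gam) w ++ [:: CTop]) sv
            (size (take p s ++ map (@CG Gam) w))
| as_create w s sv p :
    0 < p ->
    act_sem (ACreate w) s sv p (take p s ++ CCent :: map (@CG Gam) w ++ [:: CTop])
            (drop p s :: sv) (size (take p s ++ CCent :: map (@CG Gam) w))
| as_destroy pre suf sv :
    act_sem ADestroy (pre ++ [:: CCent; CTop]) (suf :: sv) (size pre)
            (pre ++ suf) sv (size pre).

(* configurations: state, remaining input, accessible stack, saved suffixes,
   stack pointer position *)
Definition config (Sigma : finType) (A : nsa Sigma) : Type :=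
  (nsa_state A * seq Sigma * seq (cell (nsa_gam A)) * seq (seq (cell (nsa_gam A))) * nat)%type.

Inductive nsa_step (Sigma : finType) (A : nsa Sigma) : config A -> config A -> Prop :=
| NStep q r s sv p q' adv act s' sv' p' :
    List.In (q, ohead r, nth CBot s p, q', adv, act) (nsa_trans A) ->
    p < size s ->
    (adv -> r <> [::]) ->
    act_sem act s sv p s' sv' p' ->
    nsa_step (q, r, s, sv, p) (q', (if adv then behead r else r), s', sv', p').

Inductive star (T : Type) (R : T -> T -> Prop) : T -> T -> Prop :=
| star_refl x : star R x x
| star_step x y z : R x y -> star R y z -> star R x z.

Definition nsa_accepts (Sigma : finType) (A : nsa Sigma) (w : seq Sigma) : Prop :=
  exists q s sv p,
    star (@nsa_step Sigma A)
      (nsa_start A, w, [:: CBot; CG (nsa_Z0 A); CTop], [::], 1)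
      (q, [::], s, sv, p) /\ @nsa_final Sigma A q.

(* Main.v *)
(* A string v of R(alpha) need not be dereferenced from left to right: the value of an
   occurrence of \i is found by going left to the nearest [_i and reading from there up to
   ]_i, recursively evaluating the numbers met on the way.  A nested stack automaton can do
   exactly this.  It guesses v symbol by symbol on its stack, following a finite automaton for
   R(alpha) and reading the letters from the input.  Whenever a number stands under the
   pointer, it creates a substack there which remembers the label being read at that moment,
   moves left to the [_i, reads up to ]_i (with nested substacks for the numbers in between),
   moves right to the top of the substack, recovers the remembered label, destroys the
   substack and resumes.  The calls nest properly because each one only visits positions to
   the left of its caller. *)
Require Import Defs.
From HB Require Import structures.
From mathcomp Require Import all_boot zify.

Set Implicit Arguments.
Unset Strict Implicit.
Unset Printing Implicit Defensive.

(** * Recursive evaluation of backreferences *)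

Lemma map_eq_cat (A B : Type) (f : A -> B) l a b :
  map f l = a ++ b ->
  exists la lb, [/\ l = la ++ lb, map f la = a & map f lb = b].
Proof.
elim: a l => [|x a IH] l /=; first by move=> <-; exists [::], l.
case: l => //= y l [<-] /IH [la [lb [-> <- <-]]].
by exists (y :: la), lb.
Qed.

(** With [cat_first_inj] it makes the capture that a number refers to unique: the nearest opening
    bracket is a last occurrence, and its closing bracket is a first one. *)
Lemma cat_last_inj (T : Type) (P : pred T) a x b a' x' b' :
  P x -> P x' -> ~~ has P b -> ~~ has P b' ->
  a ++ x :: b = a' ++ x' :: b' -> [/\ a = a', x = x' & b = b'].
Proof.
move=> Px Px'; elim: a a' => [|y a IH] [|y' a'] //= nb nb' [].
- by move=> -> ->.
- by move=> _ eb; move: nb; rewrite eb has_cat /= Px' orbT.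
- by move=> _ eb; move: nb'; rewrite -eb has_cat /= Px orbT.
- by move=> -> /(IH _ nb nb') [-> -> ->].
Qed.

Lemma cat_first_inj (T : Type) (P : pred T) a x b a' x' b' :
  P x -> P x' -> ~~ has P a -> ~~ has P a' ->
  a ++ x :: b = a' ++ x' :: b' -> [/\ a = a', x = x' & b = b'].
Proof.
move=> Px Px'; elim: a a' => [|y a IH] [|y' a'] //=.
- by move=> _ _ [-> ->].
- by move=> _ + [e]; rewrite -e Px.
- by move=> + _ [e]; rewrite e Px'.
- by rewrite !negb_or => /andP[_ na] /andP[_ na'] [-> /(IH _ na na') [-> -> ->]].
Qed.

Section Expansion.

(** [S] is a type of codes for symbols: [sym Sigma] has infinitely many labels, whereas a stack
    alphabet must be finite. *)
Variables (Sigma S : Type) (dec : S -> sym Sigma).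

Local Notation opens j := (isOpen j \o dec).
Local Notation closes j := (isClose j \o dec).

(* [expand p u w]: w is the dereferenced form of u, brackets kept, when u is preceded by p;
   p and u are undereferenced.  [value p j r]: a number j preceded by p stands for r. *)
Inductive expand : seq S -> seq S -> seq (sym Sigma) -> Prop :=
| expand_nil p : expand p [::] [::]
| expand_sym p x u w :
    ~~ isNum (dec x) -> expand (rcons p x) u w -> expand p (x :: u) (dec x :: w)
| expand_num p x j u r w :
    dec x = SNum j -> value p j r -> expand (rcons p x) u w ->
    expand p (x :: u) (map (@SL Sigma) r ++ w)
with value : seq S -> nat -> seq Sigma -> Prop :=
| value_none p j : ~~ has (opens j) p -> value p j [::]
| value_cap p1 o t c p3 j w :
    dec o = SOpen j -> dec c = SClose j ->
    ~~ has (opens j) (t ++ c :: p3) -> ~~ has (closes j) t ->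
    expand (rcons p1 o) t w -> value (p1 ++ o :: t ++ c :: p3) j (gh w).

Scheme expand_mut := Minimality for expand Sort Prop
  with value_mut := Minimality for value Sort Prop.
Combined Scheme expand_value_ind from expand_mut, value_mut.

(** * Splitting and inverting expansions *)

Lemma gh_cat (u v : seq (sym Sigma)) : gh (u ++ v) = gh u ++ gh v.
Proof. by rewrite /gh map_cat flatten_cat. Qed.

Lemma gh_SL (r : seq Sigma) : gh (map (@SL Sigma) r) = r.
Proof. by elim: r => //= a r IH; rewrite -{2}IH. Qed.

Lemma has_SL (P : pred (sym Sigma)) (r : seq Sigma) :
  (forall a, ~~ P (SL a)) -> ~~ has P (map (@SL Sigma) r).
Proof. by move=> nP; elim: r => //= a r IH; rewrite negb_or nP. Qed.

Lemma expand_cat p u v w1 w2 : expand p u w1 -> expand (p ++ u) v w2 ->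
  expand p (u ++ v) (w1 ++ w2).
Proof.
elim=> {p u w1} [p|p x u w nx _ IH|p x j u r w dx d _ IH].
- by rewrite cats0.
- by rewrite -cat_rcons => /IH; apply: expand_sym.
- by rewrite -cat_rcons -catA => /IH; apply: expand_num dx d.
Qed.

Lemma expand_catI p u v w :
  expand p (u ++ v) w -> exists w1 w2, [/\ w = w1 ++ w2, expand p u w1 & expand (p ++ u) v w2].
Proof.
move E: (u ++ v) => uv H; elim: H u E => {p uv w} [p|p x u' w nx H IH|p x j u' r w dx d H IH] u.
- case: u => //= ->; exists [::], [::].
  by split=> //; apply: expand_nil.
- case: u => [|y u] /=.
    by move=> ->; exists [::], (dec x :: w); rewrite cats0; split=> //; constructor.
  case=> ey /IH [w1 [w2 [-> h1 h2]]]; subst y; exists (dec x :: w1), w2.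
  by split; [|apply: expand_sym|rewrite -cat_rcons].
- case: u => [|y u] /=.
    move=> ->; exists [::], (map (@SL Sigma) r ++ w); rewrite cats0.
    by split=> //; [constructor|apply: expand_num dx d H].
  case=> ey /IH [w1 [w2 [-> h1 h2]]]; subst y.
  exists (map (@SL Sigma) r ++ w1), w2.
  by split; [rewrite catA|apply: expand_num dx d h1|rewrite -cat_rcons].
Qed.

Lemma expand_nonum p u : ~~ has (@isNum Sigma) (map dec u) -> expand p u (map dec u).
Proof.
elim: u p => [|x u IH] p /=; first by constructor.
by rewrite negb_or => /andP[nx /IH h]; apply: expand_sym.
Qed.

(** Dereferencing keeps the brackets and inserts only letters, so a search for a bracket gives the
    same answer before and after it. This is why a capture can be located in the undereferenced
    string. *)
Lemma expand_has (P : pred (sym Sigma)) p u w :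
  (forall a, ~~ P (SL a)) -> (forall i, ~~ P (SNum i)) ->
  expand p u w -> has P w = has (P \o dec) u.
Proof.
move=> nL nN; elim=> {p u w} //= [p x u w nx _ ->|p x j u r w dx _ _ IH] //.
by rewrite has_cat IH (negbTE (has_SL r nL)) dx (negbTE (nN j)).
Qed.

Lemma expand_isNum p u w : expand p u w -> ~~ has (@isNum Sigma) w.
Proof.
elim=> {p u w} //= [p x u w nx _ IH|p x j u r w _ _ _ IH].
  by rewrite negb_or nx.
by rewrite has_cat negb_or IH has_SL.
Qed.

(** A bracket of the expanded string comes from a bracket of the source. Letters are excluded for
    [b] since they may stem from the value of a number. *)
Lemma expand_unsplit p u w1 b w2 :
  ~~ isNum b -> (if b is SL _ then false else true) -> expand p u (w1 ++ b :: w2) ->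
  exists u1 y u2, [/\ u = u1 ++ y :: u2, dec y = b, expand p u1 w1
                    & expand (rcons (p ++ u1) y) u2 w2].
Proof.
move=> nb bb; move E: (w1 ++ b :: w2) => w H.
elim: H w1 E => {p u w} [p|p x u w nx H IH|p x j u r w dx d H IH] w1.
- by case: w1.
- case: w1 => [|z w1] /=.
    by case=> -> ->; exists [::], x, u; split=> //; [constructor|rewrite cats0].
  case=> -> /IH [u1 [y [u2 [-> dy h1 h2]]]]; exists (x :: u1), y, u2.
  by split=> //; [apply: expand_sym|rewrite -cat_rcons].
(* As [b] is not a letter, it lies beyond the inserted value [r]. *)
- move=> E; have [w1' ew1 E'] : exists2 w1', w1 = map (@SL Sigma) r ++ w1' & w1' ++ b :: w2 = w.
    elim: r w1 E {d} => [|a r IHr] [|z w1] //= E; try by eexists; [reflexivity|].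
      by case: E bb => ->.
    by case: E => -> /IHr [w1' -> <-]; exists w1'.
  have [u1 [y [u2 [-> dy h1 h2]]]] := IH _ E'; exists (x :: u1), y, u2.
  split=> //; last by rewrite -cat_rcons.
  by rewrite ew1; apply: expand_num dx d h1.
Qed.

Lemma expand_nilI p w : expand p [::] w -> w = [::].
Proof. by move E: [::] => u H; case: H E. Qed.

Lemma expand_symI p x u w :
  ~~ isNum (dec x) -> expand p (x :: u) w ->
  exists2 w', w = dec x :: w' & expand (rcons p x) u w'.
Proof.
move=> nx; move E: (x :: u) => xu H; case: H E => // {p xu w} [p x' u' w _ H|p x' j u' r w dx _ _].
  by case=> ? ?; subst; exists w.
by case=> ex _; move: nx; rewrite ex dx.
Qed.

Lemma expand_numI p x j u w :
  dec x = SNum j -> expand p (x :: u) w ->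
  exists r w', [/\ value p j r, w = map (@SL Sigma) r ++ w' & expand (rcons p x) u w'].
Proof.
move=> dx; move E: (x :: u) => xu H.
case: H E => // {p xu w} [p x' u' w nx _|p x' i u' r w dx' d H].
  by case=> ex _; move: nx; rewrite -ex dx.
by case=> ? ?; subst; exists r, w; split=> //; move: dx'; rewrite dx => -[->].
Qed.

(** * Agreement of recursive evaluation with leftmost dereferencing *)

Lemma expand_det p u w : expand p u w -> forall w', expand p u w' -> w = w'.
Proof.
move: p u w; apply: (@expand_mut (fun p u w => forall w', expand p u w' -> w = w')
  (fun p j r => forall r', value p j r' -> r = r')).
- by move=> p w' /expand_nilI.
- by move=> p x u w nx _ IH w' /(expand_symI nx) [w1 -> /IH ->].
- by move=> p x j u r w dx _ IHd _ IH w' /(expand_numI dx) [r' [w1 [/IHd -> -> /IH ->]]].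
- move=> p j np r' H; case: H np => // {p j} p1 o t c p3 j w hO _ _ _ _.
  by rewrite has_cat /= hO /= eqxx orbT.
- move=> p1 o t c p3 j w hO hC no nc _ IH r'.
  move E: (p1 ++ _) => p H; case: H E hO hC no nc => {p j r'} [p j np E|].
    by move=> hO; move: np; rewrite -E has_cat /= hO /= eqxx orbT.
  move=> q1 o' t' c' q3 j w' hO' hC' no' nc' H E hO hC no nc.
  (* Both derivations use the same opening bracket, the last one, and then the same closing bracket,
     the first one after it. *)
  have [] := @cat_last_inj _ (opens j) _ _ _ _ _ _ _ _ _ _ E; rewrite //= ?hO ?hO' /= ?eqxx //.
  move=> ? ? E'; subst q1 o'.
  have [] := @cat_first_inj _ (closes j) _ _ _ _ _ _ _ _ _ _ E'; rewrite //= ?hC ?hC' /= ?eqxx //.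
  by move=> ? _ _; subst t'; rewrite (IH _ H).
Qed.

(** Invariant of leftmost dereferencing: the current string is the dereferenced form [w] of a prefix
    [p], followed by the untouched rest [u]. A number at the head of [u] is the leftmost one, and
    replacing it moves it into the prefix. *)
Lemma expand_deref p u w' w :
  expand p u w' -> expand [::] p w -> deref (w ++ map dec u) (gh (w ++ w')).
Proof.
move=> H; elim: H w => {p u w'} [p|p x u w' nx H IH|p x j u r w' dx d H IH] w E.
- by rewrite !cats0; apply: deref_done; apply: expand_isNum E.
- have := IH (rcons w (dec x)); rewrite !cat_rcons; apply.
  rewrite -!cats1; apply: expand_cat => //.
  by apply: expand_sym => //; constructor.
- have E' : expand [::] (rcons p x) (w ++ map (@SL Sigma) r).
    rewrite -[rcons p x]cats1; apply: expand_cat => //=.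
    by rewrite -[map _ r]cats0; apply: expand_num dx d _; constructor.
  move/IH: E'; rewrite /= dx.
  case: d E => {p j r H IH dx} [p j np E|p1 o t c p3 j wt hO hC no nc H].
    rewrite cats0 /=; apply: deref_del; first exact: expand_isNum E.
    by rewrite (expand_has _ _ E).
  (* The word [w] is split along [p]; both brackets of the capture survive in it. *)
  move=> E; have nE := expand_isNum E; move: E nE.
  case/expand_catI=> w1 [w2 [-> E1 E2]].
  case/expand_symI: E2; first by rewrite hO.
  move=> w2' -> /expand_catI [wt' [w3 [-> E3 E4]]].
  case/expand_symI: E4; first by rewrite hC.
  move=> w3' -> E5.
  (* By determinism, the text between the brackets in [w] is the expansion [wt] used by [value]. *)
  rewrite (expand_det E3 H) hO hC -!catA /= -!catA /= => nE.
  apply: deref_rep => //.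
    move: no; rewrite !has_cat /= hC /= => no.
    by rewrite (expand_has _ _ H) // (expand_has _ _ E5).
  by rewrite (expand_has _ _ H).
Qed.

Lemma split_first_num w u pre i post :
  ~~ has (@isNum Sigma) w -> ~~ has (@isNum Sigma) pre ->
  w ++ map dec u = pre ++ SNum i :: post ->
  exists u1 x u2, [/\ u = u1 ++ x :: u2, pre = w ++ map dec u1, dec x = SNum i
                    & post = map dec u2].
Proof.
elim: w pre => [|y w IH] [|z pre] //=.
- by case: u => //= x u _ _ [dx <-]; exists [::], x, u.
- move=> _ np /(@map_eq_cat _ _ _ _ (z :: pre)) [u1 [[|x u2] [-> <- //= [dx <-]]]].
  by exists u1, x, u2.
- by move=> + _ [ey _]; rewrite ey.
- rewrite !negb_or => /andP[_ nw] /andP[_ np] [-> /(IH _ nw np)].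
  by move=> [u1 [x [u2 [-> -> dx ->]]]]; exists u1, x, u2.
Qed.

(** The same invariant, read off a run of [deref]. The symbols [u1] before the leftmost number
    contain no number and expand to themselves; they join the prefix together with that number. *)
Lemma deref_expand p u w r :
  expand [::] p w -> deref (w ++ map dec u) r -> exists2 w', expand p u w' & r = gh (w ++ w').
Proof.
move E: (w ++ map dec u) => s H D.
elim: D p u w E H => {s r} [s ns|pre i post r nn no D IH|p1 t p3 i post r nn no nc D IH] p u w E H.
- subst s; move: ns; rewrite has_cat negb_or => /andP[_ nu].
  by exists (map dec u) => //; apply: expand_nonum.
- have [u1 [x [u2 [-> epre dx epost]]]] := split_first_num (expand_isNum H) nn E.
  move: nn no IH; rewrite epre epost => nn no IH.
  have Hu1 q : expand q u1 (map dec u1).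
    by apply: expand_nonum; move: nn; rewrite has_cat negb_or => /andP[].
  have H1 : expand [::] (p ++ u1) (w ++ map dec u1) by apply: expand_cat.
  have Hd : value (p ++ u1) i [::] by apply: value_none; rewrite -(expand_has _ _ H1).
  have H2 : expand [::] (rcons (p ++ u1) x) (w ++ map dec u1).
    rewrite -cats1 -[w ++ _]cats0; apply: expand_cat => //.
    exact: expand_num dx Hd (expand_nil _).
  have [w' Hw' ->] := IH _ _ _ erefl H2.
  exists (map dec u1 ++ w'); last by rewrite catA.
  by apply: expand_cat => //; apply: expand_num dx Hd Hw'.
- have E1 : w ++ map dec u = (p1 ++ SOpen i :: t ++ SClose i :: p3) ++ SNum i :: post.
    by rewrite E -!catA /= -!catA.
  have [u1 [x [u2 [-> epre dx epost]]]] := split_first_num (expand_isNum H) nn E1.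
  have Hu1 q : expand q u1 (map dec u1).
    by apply: expand_nonum; move: nn; rewrite epre has_cat negb_or => /andP[].
  have H1 : expand [::] (p ++ u1) (w ++ map dec u1) by apply: expand_cat.
  have Hd : value (p ++ u1) i (gh t).
    move: H1; rewrite -epre => H1.
    (* The step finds its brackets in the dereferenced prefix. Both are pulled back to the source,
       where [t] is the expansion of what they enclose. *)
    have [q1 [o [q2 [-> hO Hq1 /= ]]]] := @expand_unsplit _ _ _ (SOpen i) _ isT isT H1.
    case/(@expand_unsplit _ _ _ (SClose i) _ isT isT) => q3 [c [q4 [-> hC Hq3 Hq4]]].
    apply: value_cap => //.
      move: no; rewrite !has_cat /= hC /=.
      by rewrite (expand_has _ _ Hq3) // (expand_has _ _ Hq4).
    by rewrite -(expand_has _ _ Hq3).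
  have H2 : expand [::] (rcons (p ++ u1) x) (w ++ map dec u1 ++ map (@SL Sigma) (gh t)).
    rewrite -cats1 catA; apply: expand_cat => //.
    by rewrite -[map _ (gh t)]cats0; apply: expand_num dx Hd _; constructor.
  have [|w' Hw' ->] := IH (rcons (p ++ u1) x) u2 _ _ H2.
    by rewrite -epost catA -epre -!catA /= -!catA.
  exists (map dec u1 ++ map (@SL Sigma) (gh t) ++ w'); last by rewrite !catA.
  by apply: expand_cat => //; apply: expand_num dx Hd Hw'.
Qed.

End Expansion.

(** * A finite automaton for R(alpha) *)

Inductive rx (T : Type) : Type :=
| XAtom of T
| XEps
| XCat of rx T & rx T
| XUnion of rx T & rx T
| XStar of rx T.

Arguments XEps {T}.

Inductive rx_lang (T : Type) : rx T -> seq T -> Prop :=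
| rx_lang_atom x : rx_lang (XAtom x) [:: x]
| rx_lang_eps : rx_lang XEps [::]
| rx_lang_cat a b u v : rx_lang a u -> rx_lang b v -> rx_lang (XCat a b) (u ++ v)
| rx_lang_unionl a b u : rx_lang a u -> rx_lang (XUnion a b) u
| rx_lang_unionr a b u : rx_lang b u -> rx_lang (XUnion a b) u
| rx_lang_star0 a : rx_lang (XStar a) [::]
| rx_lang_starS a u v : rx_lang a u -> rx_lang (XStar a) v -> rx_lang (XStar a) (u ++ v).

Lemma rx_lang_atomI (T : Type) (x : T) w : rx_lang (XAtom x) w -> w = [:: x].
Proof. by move=> H; inversion H. Qed.

Lemma rx_lang_catI (T : Type) (a b : rx T) w :
  rx_lang (XCat a b) w -> exists u v, [/\ w = u ++ v, rx_lang a u & rx_lang b v].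
Proof. by move=> H; inversion H; subst; exists u, v. Qed.

(** An encoding by generic trees, which equips [rx T] with decidable equality and choice. *)
Fixpoint rx_tree (T : Type) (a : rx T) : GenTree.tree T :=
  match a with
  | XAtom x => GenTree.Leaf x
  | XEps => GenTree.Node 0 [::]
  | XCat a b => GenTree.Node 1 [:: rx_tree a; rx_tree b]
  | XUnion a b => GenTree.Node 2 [:: rx_tree a; rx_tree b]
  | XStar a => GenTree.Node 3 [:: rx_tree a]
  end.

Fixpoint tree_rx (T : Type) (t : GenTree.tree T) : rx T :=
  match t with
  | GenTree.Leaf x => XAtom x
  | GenTree.Node 1 [:: a; b] => XCat (tree_rx a) (tree_rx b)
  | GenTree.Node 2 [:: a; b] => XUnion (tree_rx a) (tree_rx b)
  | GenTree.Node 3 [:: a] => XStar (tree_rx a)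
  | _ => XEps
  end.

Lemma rx_treeK (T : Type) : cancel (@rx_tree T) (@tree_rx T).
Proof. by elim=> //= [a -> b ->|a -> b ->|a ->]. Qed.

HB.instance Definition _ (T : choiceType) := Choice.copy (rx T) (can_type (@rx_treeK T)).

Inductive nfa_lang (T : Type) (Q : Type) (E : Q -> option T -> Q -> bool) (F : pred Q) :
  Q -> seq T -> Prop :=
| nfa_nil q : F q -> nfa_lang E F q [::]
| nfa_eps q q' u : E q None q' -> nfa_lang E F q' u -> nfa_lang E F q u
| nfa_sym q x q' u : E q (Some x) q' -> nfa_lang E F q' u -> nfa_lang E F q (x :: u).

(** * The automaton of partial derivatives *)

Section Derivatives.

Variable T : choiceType.
Implicit Types a b c : rx T.

(* Antimirov's partial derivatives, slowed down by epsilon moves so that no nullability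
   test is needed. *)
Fixpoint rx_steps a : seq (option T * rx T) :=
  match a with
  | XAtom x => [:: (Some x, XEps)]
  | XEps => [::]
  | XCat a b => [seq (e.1, XCat e.2 b) | e <- rx_steps a]
                  ++ (if a is XEps then [:: (None, b)] else [::])
  | XUnion a b => [:: (None, a); (None, b)]
  | XStar a => [:: (None, XEps); (None, XCat a (XStar a))]
  end.

(** A finite list that contains [a] and is closed under [rx_steps]; it provides the state set. *)
Fixpoint rx_reach a : seq (rx T) :=
  a :: match a with
  | XAtom _ => [:: XEps]
  | XEps => [::]
  | XCat a b => [seq XCat c b | c <- rx_reach a] ++ rx_reach b
  | XUnion a b => rx_reach a ++ rx_reach b
  | XStar a => XEps :: [seq XCat c (XStar a) | c <- rx_reach a]
  end.

Lemma rx_reach_refl a : a \in rx_reach a.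
Proof. by case: a => *; rewrite inE eqxx. Qed.

Lemma rx_reach_closed a b e : b \in rx_reach a -> e \in rx_steps b -> e.2 \in rx_reach a.
Proof.
(* Common to concatenation and star: derivatives act on the left factor of [XCat b' a2] until it is
   [XEps], and then [a2] remains. *)
have reach_cat a1 a2 (L : seq (rx T)) :
    (forall b e, b \in rx_reach a1 -> e \in rx_steps b -> e.2 \in rx_reach a1) ->
    {subset [seq XCat c a2 | c <- rx_reach a1] <= L} -> a2 \in L ->
    forall b' e, b' \in rx_reach a1 -> e \in rx_steps (XCat b' a2) -> e.2 \in L.
  move=> IH sub La2 b' e' hb'; rewrite /= mem_cat => /orP[/mapP[d hd ->]|].
    by apply/sub/map_f; apply: IH hb' hd.
  by case: b' hb' => // _; rewrite inE => /eqP ->.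
elim: a b e => [x||a1 IH1 a2 IH2|a1 IH1 a2 IH2|a1 IH1] b e /=.
- by rewrite !inE => /orP[] /eqP -> //=; rewrite inE => /eqP -> /=; rewrite ?eqxx ?orbT.
- by rewrite inE => /eqP ->.
- set L := _ :: _; have La2 : a2 \in L by rewrite inE mem_cat rx_reach_refl !orbT.
  have sub : {subset [seq XCat c a2 | c <- rx_reach a1] <= L}.
    by move=> c hc; rewrite inE mem_cat hc orbT.
  have Lcat := reach_cat _ _ _ IH1 sub La2.
  rewrite {1}/L inE mem_cat => /or3P[/eqP ->|/mapP[c hc ->]|hb he].
  + exact/Lcat/rx_reach_refl.
  + exact: Lcat.
  + by rewrite inE mem_cat (IH2 _ _ hb he) !orbT.
- rewrite inE mem_cat => /or3P[/eqP ->|hb he|hb he].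
  + by rewrite !inE => /orP[] /eqP -> /=; rewrite ?inE ?mem_cat ?rx_reach_refl ?orbT.
  + by rewrite inE mem_cat (IH1 _ _ hb he) orbT.
  + by rewrite inE mem_cat (IH2 _ _ hb he) !orbT.
- set L := _ :: _.
  have sub : {subset [seq XCat c (XStar a1) | c <- rx_reach a1] <= L}.
    by move=> c hc; rewrite !inE hc !orbT.
  have Lcat := reach_cat _ _ _ IH1 sub (mem_head _ _).
  rewrite {1}/L !inE => /or3P[/eqP ->|/eqP ->|/mapP[c hc ->]] //.
  + rewrite !inE => /orP[] /eqP -> /=; rewrite ?inE ?eqxx ?orbT //.
    by rewrite map_f ?orbT ?rx_reach_refl.
  + exact: Lcat.
Qed.

Local Notation E := (fun a x b => (x, b) \in rx_steps a).
Local Notation F := (pred1 XEps).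

Lemma rx_steps_lang a x b u :
  (x, b) \in rx_steps a -> rx_lang b u -> rx_lang a (seq_of_opt x ++ u).
Proof.
elim: a x b u => [y||a1 IH1 a2 IH2|a1 IH1 a2 IH2|a1 IH1] x b u //=.
- rewrite inE => /eqP[-> ->] H; inversion H; exact: rx_lang_atom.
- rewrite mem_cat => /orP[/mapP[[x' c] hc [-> ->]] H|].
    by inversion H; subst; rewrite catA; apply: rx_lang_cat => //; apply: IH1 hc _.
  case: a1 {IH1} => //; rewrite inE => /eqP[-> ->] H.
  by apply: (rx_lang_cat (rx_lang_eps _) H).
- by rewrite !inE => /orP[] /eqP[-> ->] H; [apply: rx_lang_unionl|apply: rx_lang_unionr].
- rewrite !inE => /orP[] /eqP[-> ->] H; inversion H; subst; first exact: rx_lang_star0.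
  by rewrite /=; apply: rx_lang_starS.
Qed.

(** A run from [a] is lifted to the left factor; it ends in [XCat XEps b], from which an epsilon
    move leads to [b]. *)
Lemma nfa_cat a b u v : nfa_lang E F a u -> nfa_lang E F b v -> nfa_lang E F (XCat a b) (u ++ v).
Proof.
move=> H Hb; elim: H => {a u} [a /eqP ->|a a' u ea _ IH|a x a' u ea _ IH].
- by apply: nfa_eps Hb; rewrite inE.
- apply: nfa_eps IH; rewrite mem_cat; apply/orP; left.
  by apply/mapP; exists (None, a').
- apply: nfa_sym IH; rewrite mem_cat; apply/orP; left.
  by apply/mapP; exists (Some x, a').
Qed.

Lemma rx_nfaP a u : rx_lang a u <-> nfa_lang E F a u.
Proof.
split.
- elim=> {a u} [x||a b u v _ IHa _ IHb|a b u _ IH|a b u _ IH|a|a u v _ IHa _ IHs].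
  + by apply: (@nfa_sym _ _ _ _ _ x XEps); rewrite ?inE //; apply: nfa_nil.
  + exact: nfa_nil.
  + exact: nfa_cat.
  + by apply: nfa_eps IH; rewrite !inE eqxx.
  + by apply: nfa_eps IH; rewrite !inE eqxx orbT.
  + by apply: (@nfa_eps _ _ _ _ _ XEps); rewrite ?inE //; apply: nfa_nil.
  + by apply: nfa_eps (nfa_cat IHa IHs); rewrite !inE eqxx orbT.
- elim=> {a u} [a /eqP ->|a a' u ea _ IH|a x a' u ea _ IH]; first exact: rx_lang_eps.
  + exact: (rx_steps_lang ea IH).
  + exact: (rx_steps_lang ea IH).
Qed.

(** Runs that start in [a] stay in [rx_reach a], so the automaton can be restricted to that finite
    set. *)
Lemma rx_finite_nfa a :
  exists (Q : finType) (D : Q -> option T -> Q -> bool) (G : pred Q) (q0 : Q),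
    forall u, rx_lang a u <-> nfa_lang D G q0 u.
Proof.
exists (seq_sub (rx_reach a)), (fun q x q' => E (val q) x (val q')), (fun q => F (val q)).
exists (SeqSub (rx_reach_refl a)) => u; rewrite rx_nfaP; split.
(* The start state is generalised for the induction, while the [a] of [rx_reach a] has to stay
   fixed. *)
- set q0 := SeqSub _; rewrite -[a in X in X -> _]/(val q0); move: q0 => q0.
  move Eb: (val q0) => b H; elim: H q0 Eb => {u b} [b Fb|b b' u eb _ IH|b x b' u eb _ IH] q0 Eb.
  + by apply: nfa_nil; rewrite Eb.
  + have hb' : b' \in rx_reach a by apply: rx_reach_closed eb; rewrite -Eb; apply: ssvalP.
    by apply: (@nfa_eps _ _ _ _ _ (SeqSub hb')); [rewrite Eb|apply: IH].
  + have hb' : b' \in rx_reach a by apply: rx_reach_closed eb; rewrite -Eb; apply: ssvalP.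
    by apply: (@nfa_sym _ _ _ _ _ _ (SeqSub hb')); [rewrite Eb|apply: IH].
- set q0 := SeqSub _; rewrite -[a in X in _ -> X]/(val q0); move: q0 => q0.
  elim=> {q0 u} [q Fq|q q' u e _ IH|q x q' u e _ IH].
  + exact: nfa_nil.
  + exact: nfa_eps e IH.
  + exact: nfa_sym e IH.
Qed.

End Derivatives.

(** * Rewbs as regular expressions over a finite alphabet *)

Section Translation.

Variables (Sigma : finType) (k : nat).

(** A finite set of codes for the symbols with labels up to [k]. In ['I_k.+1] the labels 1 to [k]
    are represented by themselves, so [inord] is faithful on them. *)
Definition tok : finType := (Sigma + option bool * 'I_k.+1)%type.

Definition tok_sym (x : tok) : sym Sigma :=
  match x with
  | inl a => SL a
  | inr (None, i) => SNum i
  | inr (Some true, i) => SOpen i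
  | inr (Some false, i) => SClose i
  end.

Fixpoint rx_of (a : rewb Sigma) : rx tok :=
  match a with
  | RChar a => XAtom (inl a)
  | REps => XEps
  | RRef i => XAtom (inr (None, inord i))
  | RCat a b => XCat (rx_of a) (rx_of b)
  | RUnion a b => XUnion (rx_of a) (rx_of b)
  | RStar a => XStar (rx_of a)
  | RCap j a => XCat (XAtom (inr (Some true, inord j)))
                     (XCat (rx_of a) (XAtom (inr (Some false, inord j))))
  end.

Lemma rx_ofP a v :
  in_REWB k a -> (inR a v <-> exists2 u, rx_lang (rx_of a) u & v = map tok_sym u).
Proof.
move=> hk; split.
- move=> H; elim: H hk => {a v} /=.
  + by move=> a _; exists [:: inl a] => //; apply: rx_lang_atom.
  + by move=> _; exists [::] => //; apply: rx_lang_eps.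
  + move=> i /andP[_ ik]; eexists; first exact: rx_lang_atom.
    by rewrite /= inordK.
  + move=> a b u v _ IHa _ IHb [/IHa [u' hu ->] /IHb [v' hv ->]].
    by exists (u' ++ v'); [apply: rx_lang_cat|rewrite map_cat].
  + by move=> a b u _ IH [/IH [u' hu ->] _]; exists u' => //; apply: rx_lang_unionl.
  + by move=> a b u _ IH [_ /IH [u' hu ->]]; exists u' => //; apply: rx_lang_unionr.
  + by move=> a _; exists [::] => //; apply: rx_lang_star0.
  + move=> a u v _ IHa _ IHb hk; have [u' hu ->] := IHa hk; have [v' hv ->] := IHb hk.
    by exists (u' ++ v'); [apply: rx_lang_starS|rewrite map_cat].
  + move=> j a u _ IH [/andP[_ jk] _ /IH [u' hu ->]].
    eexists; first exact: (rx_lang_cat (rx_lang_atom _) (rx_lang_cat hu (rx_lang_atom _))).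
    by rewrite /= map_cat /= inordK.
- case=> u + ->; elim: a hk u {v} => /=.
  + by move=> a _ u H; inversion H; apply: inR_char.
  + by move=> _ u H; inversion H; apply: inR_eps.
  + move=> i /andP[_ ik] u H; inversion H; rewrite /= inordK //; exact: inR_ref.
  + move=> a IHa b IHb [/IHa ha /IHb hb] u H; inversion H; subst.
    by rewrite map_cat; apply: inR_cat; [apply: ha|apply: hb].
  + move=> a IHa b IHb [/IHa ha /IHb hb] u H; inversion H; subst.
      by apply: inR_unionl; apply: ha.
    by apply: inR_unionr; apply: hb.
  + move=> a IHa /IHa ha u; move E: (XStar _) => s H; elim: H E => // {s u}.
      by move=> b _; apply: inR_star0.
    move=> b u v hu _ _ IH [eb]; subst b; rewrite map_cat.
    by apply: inR_starS; [apply: ha|apply: IH].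
  + move=> j a IHa [/andP[_ jk] _ /IHa ha] u.
    case/rx_lang_catI=> o [v [-> ho]]; case/rx_lang_catI=> u' [c [-> /ha hu hc]].
    rewrite (rx_lang_atomI ho) (rx_lang_atomI hc).
    by rewrite /= map_cat /= inordK //; exact: inR_cap hu.
Qed.

End Translation.

(** * The nested stack automaton *)

(* [Main q]: guessing v, q being the state of the automaton for R(alpha).  The other states
   keep q for later.  [Walk q b]: reading the capture of label b, where b = None means that
   the pointer is on a number just pushed by [Main].  [Seek q x]: moving left to the capture
   that x refers to.  [Ret], [Pop] and [Destroy]: the stages of leaving a substack, after which
   [Resume q b] has the pointer back on the number that caused the call. *)
Inductive mstate (S Q : Type) : Type :=
| Main of Q
| Walk of Q & option S
| Seek of Q & S
| Ret of Q
| Pop of Q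
| Destroy of Q & option S
| Resume of Q & option S.

Arguments Main {S Q}.
Arguments Ret {S Q}.
Arguments Pop {S Q}.

Definition mstate_code (S Q : Type) (m : mstate S Q) :
    Q + Q * option S + Q * S + (Q + Q) + (Q * option S + Q * option S) :=
  match m with
  | Main q => inl (inl (inl (inl q)))
  | Walk q c => inl (inl (inl (inr (q, c))))
  | Seek q x => inl (inl (inr (q, x)))
  | Ret q => inl (inr (inl q))
  | Pop q => inl (inr (inr q))
  | Destroy q c => inr (inl (q, c))
  | Resume q c => inr (inr (q, c))
  end.

Definition mstate_decode (S Q : Type)
    (m : Q + Q * option S + Q * S + (Q + Q) + (Q * option S + Q * option S)) : mstate S Q :=
  match m with
  | inl (inl (inl (inl q))) => Main q
  | inl (inl (inl (inr (q, c)))) => Walk q c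
  | inl (inl (inr (q, x))) => Seek q x
  | inl (inr (inl q)) => Ret q
  | inl (inr (inr q)) => Pop q
  | inr (inl (q, c)) => Destroy q c
  | inr (inr (q, c)) => Resume q c
  end.

Lemma mstate_codeK (S Q : Type) : cancel (@mstate_code S Q) (@mstate_decode S Q).
Proof. by case. Qed.

HB.instance Definition _ (S Q : finType) :=
  Finite.copy (mstate S Q) (can_type (@mstate_codeK S Q)).

Lemma In_flatten_enum (T : finType) (U : Type) (f : T -> seq U) y :
  List.In y (flatten [seq f x | x <- enum T]) <-> exists x, List.In y (f x).
Proof.
suff H l : List.In y (flatten [seq f x | x <- l]) <-> exists2 x, x \in l & List.In y (f x).
  by rewrite H; split=> [[x _ h]|[x h]]; exists x; rewrite ?mem_enum.
elim: l => [|x l IH] /=; first by split=> // -[].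
have in_cat (u v : seq U) : List.In y (u ++ v) <-> List.In y u \/ List.In y v.
  by elim: u => [|z u IHu] /=; [split; [right|case]|rewrite IHu; tauto].
rewrite in_cat IH; split=> [[h|[z hz h]]|[z]].
- by exists x; rewrite ?mem_head.
- by exists z; rewrite ?inE ?hz ?orbT.
- by rewrite inE => /orP[/eqP ->|hz h]; [left|right; exists z].
Qed.

Lemma star_trans (T : Type) (R : T -> T -> Prop) x y z : star R x y -> star R y z -> star R x z.
Proof. by elim=> // {x y} x x' y e _ IH /IH; apply: star_step e. Qed.

Section Machine.

Variables (Sigma S Q : finType) (dec : S -> sym Sigma).
Variables (E : Q -> option S -> Q -> bool) (F : pred Q) (q0 : Q).

Local Notation opens j := (isOpen j \o dec).
Local Notation closes j := (isClose j \o dec).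
(* A stack symbol is a symbol of v or the label remembered by a substack; [inr None] also
   serves as the initial symbol. *)
Local Notation gam := (S + option S)%type.

(* Only used on number symbols; 0 is a junk value. *)
Definition lab (x : S) : nat := if dec x is SNum j then j else 0.

(** Replacing the top symbol [z] by [z] followed by [x] is how [x] is pushed. *)
Definition main_moves (q : Q) (o : option Sigma) (z : gam) (e : option S * Q) :
    seq (mstate S Q * bool * action gam) :=
  let: (x, q') := e in
  if ~~ E q x q' then [::] else
  if x is Some x then
    match dec x with
    | SL a => if o == Some a then [:: (Main q', true, ARepl [:: z; inl x])] else [::]
    | SNum _ => [:: (Walk q' None, false, ARepl [:: z; inl x])]
    | _ => [:: (Main q', false, ARepl [:: z; inl x])]
    end
  else [:: (Main q', false, AStay)].

(** A push or the creation of a substack leaves the pointer on [CTop], hence the left moves on that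
    marker. When [Seek] meets [CBot], no capture precedes the number, so its value is empty and
    nothing is read. *)
Definition delta (m : mstate S Q) (o : option Sigma) (c : cell gam) :
    seq (mstate S Q * bool * action gam) :=
  match m, c with
  | Main q, CTop => [:: (Main q, false, ALeft)]
  | Main q, CG z => flatten [seq main_moves q o z e | e <- enum {: option S * Q}]
  | Walk q None, CTop => [:: (Walk q None, false, ALeft)]
  | Walk q b, CG (inl y) =>
      match dec y, b with
      | SNum _, _ => [:: (Seek q y, false, ACreate [:: inr b])]
      | SL a, Some x => if o == Some a then [:: (Walk q b, true, ARight)] else [::]
      | SClose i, Some x =>
          if i == lab x then [:: (Ret q, false, AStay)] else [:: (Walk q b, false, ARight)]
      | SOpen _, Some x => [:: (Walk q b, false, ARight)]
      | _, None => [::]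
      end
  | Seek q x, CBot => [:: (Ret q, false, ARight)]
  | Seek q x, CG (inl y) =>
      if isOpen (lab x) (dec y) then [:: (Walk q (Some x), false, ARight)]
      else [:: (Seek q x, false, ALeft)]
  | Seek q x, _ => [:: (Seek q x, false, ALeft)]
  | Ret q, CTop => [:: (Pop q, false, ALeft)]
  | Ret q, _ => [:: (Ret q, false, ARight)]
  | Pop q, CG (inr b) => [:: (Destroy q b, false, ARepl [::])]
  | Destroy q b, CTop => [:: (Destroy q b, false, ALeft)]
  | Destroy q b, CCent => [:: (Resume q b, false, ADestroy)]
  | Resume q None, _ => [:: (Main q, false, AStay)]
  | Resume q (Some x), _ => [:: (Walk q (Some x), false, ARight)]
  | _, _ => [::]
  end.

(** Presents the cells as the image of a finite type, so that the transition table can be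
    enumerated. *)
Definition cell_of (x : option bool + gam) : cell gam :=
  match x with
  | inl None => CBot
  | inl (Some true) => CTop
  | inl (Some false) => CCent
  | inr z => CG z
  end.

Definition machine_trans :=
  flatten [seq [seq (e.1.1, e.1.2, cell_of e.2, d.1.1, d.1.2, d.2)
               | d <- delta e.1.1 e.1.2 (cell_of e.2)]
          | e <- enum {: mstate S Q * option Sigma * (option bool + gam)}].

Lemma machine_transP m o c m' adv act :
  List.In (m, o, c, m', adv, act) machine_trans <-> List.In (m', adv, act) (delta m o c).
Proof.
rewrite In_flatten_enum; split=> [|h].
  by case=> -[[m1 o1] c1] /List.in_map_iff [[[m2 b] a] [[<- <- <- <- <- <-] /=]].
have [c' ec] : exists c', cell_of c' = c.
  by case: c {h} => [||| z];
    [exists (inl None)|exists (inl (Some true))|exists (inl (Some false))|exists (inr z)].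
exists (m, o, c'); apply/List.in_map_iff; exists (m', adv, act).
by rewrite /= ec.
Qed.

Definition machine : nsa Sigma :=
  @NSA Sigma (mstate S Q) gam (Main q0) (fun m => if m is Main q then F q else false)
    (inr None) machine_trans.

(** * Shapes of configurations and their meaning *)

Local Notation conf := (config machine).
Local Notation step := (@nsa_step Sigma machine).

Definition cg (x : S) : cell gam := CG (inl x).

(** The two cells under [v] cause the offset [.+2] in pointer positions. *)
Definition base (v : seq S) : seq (cell gam) := CBot :: CG (inr None) :: map cg v.

(* The pending calls.  [CMain y]: the call was made by [Main] on the topmost number y.
   [CWalk x y post k]: it was made on the number y, followed by post, while reading the
   capture of x inside the call k. *)
Inductive context : Type :=
| CMain of S
| CWalk of S & S & seq S & context.

Definition saved (k : context) : option S := if k is CWalk x _ _ _ then Some x else None.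

(** The substack of the current call. The part of the stack that the call cut off is [suffix k]; it
    starts with the number that caused the call. Enclosing substacks lie in the saved suffixes, so
    the accessible part contains only one substack. *)
Definition tail (k : context) : seq (cell gam) := [:: CCent; CG (inr (saved k)); CTop].

Definition suffix (k : context) : seq (cell gam) :=
  match k with
  | CMain y => [:: cg y; CTop]
  | CWalk _ y post k' => map cg (y :: post) ++ tail k'
  end.

Fixpoint saves (k : context) : seq (seq (cell gam)) :=
  suffix k :: (if k is CWalk _ _ _ k' then saves k' else [::]).

Definition main_sem (q : Q) (v : seq S) (r : seq Sigma) : Prop :=
  exists u w, [/\ nfa_lang E F q u, expand dec v u w & r = gh w].

(** In continuation style: [r] is what the reading still consumes, followed by a rest that satisfies
    [P]. Here [a] has been passed, and [b] starts at the pointer. *)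
Definition walk_sem (x : S) (a b : seq S) (P : seq Sigma -> Prop) (r : seq Sigma) : Prop :=
  exists t c p w r', [/\ b = t ++ c :: p, dec c = SClose (lab x) /\ ~~ has (closes (lab x)) t,
                         expand dec a t w, r = gh w ++ r' & P r'].

Definition seek_sem (j : nat) (v : seq S) (P : seq Sigma -> Prop) (r : seq Sigma) : Prop :=
  exists w r', [/\ value dec v j w, r = w ++ r' & P r'].

Fixpoint return_sem (k : context) (pre : seq S) (q : Q) (r : seq Sigma) : Prop :=
  match k with
  | CMain y => main_sem q (rcons pre y) r
  | CWalk x y post k' =>
      walk_sem x (rcons pre y) post (return_sem k' (rcons pre y ++ post) q) r
  end.

(* [meaning c P]: c is a reachable shape of configuration and P is what acceptance from c
   implies.  Steps preserve the shape and pull P back, whence soundness. *)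
Inductive meaning : conf -> Prop -> Prop :=
| mean_main q v r p :
    p = (size v).+1 \/ p = (size v).+2 ->
    meaning (Main q, r, base v ++ [:: CTop], [::], p) (main_sem q v r)
| mean_num q v y j r p :
    dec y = SNum j -> p = (size v).+2 \/ p = (size v).+3 ->
    meaning (Walk q None, r, base (rcons v y) ++ [:: CTop], [::], p)
      (seek_sem j v (main_sem q (rcons v y)) r)
| mean_walk q x a b k r :
    meaning (Walk q (Some x), r, base (a ++ b) ++ tail k, saves k, (size a).+2)
      (walk_sem x a b (return_sem k (a ++ b) q) r)
| mean_seek q x v k r p :
    ~~ has (opens (lab x)) (drop p.-1 v) ->
    meaning (Seek q x, r, base v ++ tail k, saves k, p)
      (seek_sem (lab x) v (return_sem k v q) r)
| mean_ret q v k r p :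
    meaning (Ret q, r, base v ++ tail k, saves k, p) (return_sem k v q r)
| mean_pop q v k r :
    meaning (Pop q, r, base v ++ tail k, saves k, (size v).+3) (return_sem k v q r)
| mean_destroy q v k r p :
    p = (size v).+2 \/ p = (size v).+3 ->
    meaning (Destroy q (saved k), r, base v ++ [:: CCent; CTop], saves k, p) (return_sem k v q r)
| mean_resume q v k r :
    meaning (Resume q (saved k), r, base v ++ suffix k, behead (saves k), (size v).+2)
      (return_sem k v q r).

(** * Cells and positions of the stack *)

Lemma size_base v : size (base v) = (size v).+2.
Proof. by rewrite /= size_map. Qed.

Lemma base_cat a b : base (a ++ b) = base a ++ map cg b.
Proof. by rewrite /base map_cat. Qed.

Lemma base_rcons v y tl : base (rcons v y) ++ tl = base v ++ cg y :: tl.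
Proof. by rewrite -cats1 base_cat -catA. Qed.

Lemma nth_base v tl m : nth CBot (base v ++ tl) ((size v).+2 + m) = nth CBot tl m.
Proof. by rewrite nth_cat size_base ltnNge leq_addr /= addKn. Qed.

Lemma take_base v tl : take (size v).+2 (base v ++ tl) = base v.
Proof. by rewrite -size_base take_size_cat. Qed.

Lemma drop_base v tl : drop (size v).+2 (base v ++ tl) = tl.
Proof. by rewrite -size_base drop_size_cat. Qed.

(** Thanks to the initial symbol, the cell below [CTop] can be replaced even when [v] is empty, so
    [Main] can always push. *)
Lemma base_last v : exists b z, base v = rcons b (CG z) /\ size b = (size v).+1.
Proof.
case/lastP: v => [|v x]; first by exists [:: CBot], (inr None).
by exists (base v), (inl x); rewrite /base map_rcons size_rcons /= size_map.
Qed.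

Lemma base_position v tl p :
  p < size (base v ++ tl) ->
  [\/ p = 0, p = 1, exists a y b, v = a ++ y :: b /\ p = (size a).+2
    | exists2 m, m < size tl & p = (size v).+2 + m].
Proof.
rewrite size_cat size_base => hp.
case: p hp => [|[|p]] hp; [by constructor 1|by constructor 2|].
have [hv|hv] := ltnP p (size v).
  constructor 3; case: v hv {hp} => // y0 v hv.
  exists (take p (y0 :: v)), (nth y0 (y0 :: v) p), (drop p.+1 (y0 :: v)).
  by rewrite -drop_nth // cat_take_drop size_take hv.
by constructor 4; exists (p - size v); [rewrite ltn_subLR // -2!ltnS -!addSn|rewrite !addSn subnKC].
Qed.

Lemma nth_base0 v tl : nth CBot (base v ++ tl) 0 = CBot.
Proof. by []. Qed.

Lemma nth_base1 v tl : nth CBot (base v ++ tl) 1 = CG (inr None).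
Proof. by []. Qed.

Lemma base_nil tl : CBot :: CG (inr None) :: tl = base [::] ++ tl.
Proof. by []. Qed.

(* Keeps [/=] from exposing the two bottom cells. *)
Opaque base.

Lemma stepI m r s sv p m' (adv : bool) act s' sv' p' :
  List.In (m', adv, act) (delta m (ohead r) (nth CBot s p)) ->
  p < size s -> (adv -> r <> [::]) -> act_sem act s sv p s' sv' p' ->
  step (m, r, s, sv, p) (m', if adv then behead r else r, s', sv', p').
Proof. by move=> /machine_transP h hp hr ha; apply: (@NStep Sigma machine _ _ _ _ _ _ _ act). Qed.

Lemma stepE m r s sv p c' :
  step (m, r, s, sv, p) c' ->
  exists m' adv act s' sv' p',
    [/\ c' = (m', if adv then behead r else r, s', sv', p'),
        List.In (m', adv, act) (delta m (ohead r) (nth CBot s p)),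
        p < size s, adv -> r <> [::] & act_sem act s sv p s' sv' p'].
Proof.
move=> H; inversion H as [q r' s0 sv0 p0 q' adv act s' sv' p' hin hp hr ha e1 e2]; subst.
by exists q', adv, act, s', sv', p'; split=> //; apply/machine_transP.
Qed.

Lemma act_leftE s sv p s' sv' p' :
  act_sem (@ALeft gam) s sv p s' sv' p' -> [/\ s' = s, sv' = sv & p' = p.-1].
Proof. by move=> H; inversion H. Qed.

Lemma act_rightE s sv p s' sv' p' :
  act_sem (@ARight gam) s sv p s' sv' p' -> [/\ s' = s, sv' = sv & p' = p.+1].
Proof. by move=> H; inversion H. Qed.

Lemma act_stayE s sv p s' sv' p' :
  act_sem (@AStay gam) s sv p s' sv' p' -> [/\ s' = s, sv' = sv & p' = p].
Proof. by move=> H; inversion H. Qed.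

Lemma act_replE w s sv p s' sv' p' :
  act_sem (@ARepl gam w) s sv p s' sv' p' ->
  [/\ s' = take p s ++ map (@CG gam) w ++ [:: CTop], sv' = sv
    & p' = size (take p s ++ map (@CG gam) w)].
Proof. by move=> H; inversion H. Qed.

Lemma act_createE w s sv p s' sv' p' :
  act_sem (@ACreate gam w) s sv p s' sv' p' ->
  [/\ s' = take p s ++ CCent :: map (@CG gam) w ++ [:: CTop], sv' = drop p s :: sv
    & p' = size (take p s ++ CCent :: map (@CG gam) w)].
Proof. by move=> H; inversion H. Qed.

Lemma act_destroyE pre suf sv p s' sv' p' :
  act_sem (@ADestroy gam) (pre ++ [:: CCent; CTop]) (suf :: sv) p s' sv' p' ->
  [/\ s' = pre ++ suf, sv' = sv & p' = size pre].
Proof.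
move=> H; inversion H as [| | | | |pre' ? ? ea e]; subst.
have epre : pre' = pre := List.app_inv_tail _ _ _ e; by rewrite epre.
Qed.

(** * Soundness: each step pulls the meaning back *)

Lemma meaning_main_step q v r p c' :
  p = (size v).+1 \/ p = (size v).+2 ->
  step (Main q, r, base v ++ [:: CTop], [::], p) c' ->
  exists2 P, meaning c' P & P -> main_sem q v r.
Proof.
case=> -> /stepE [m' [adv [act [s' [sv' [p' [-> hin _ hr ha]]]]]]].
  have [b [z [eb sb]]] := base_last v.
  move: hin ha; rewrite eb -sb cat_rcons nth_cat ltnn subnn /= In_flatten_enum.
  case=> -[x q'] /=; case e: (E q x q') => //=; case: x e => [x|] e /=; last first.
    case=> // -[<- <- <-] /act_stayE [-> -> ->] /=.
    exists (main_sem q' v r); last first.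
      by case=> u [w [hu hw ->]]; exists u, w; split=> //; apply: nfa_eps e hu.
    by rewrite -cat_rcons -eb sb; apply: mean_main; left.
  have eb' : (b ++ [:: CG z; CG (inl x)]) = base (rcons v x).
    by rewrite -cat_rcons -eb -cats1 base_cat.
  have push : forall s' sv' p',
      act_sem (ARepl [:: z; inl x]) (b ++ [:: CG z; CTop]) [::] (size b) s' sv' p' ->
      [/\ s' = base (rcons v x) ++ [:: CTop], sv' = [::] & p' = (size v).+3].
    move=> ? ? ? /act_replE; rewrite take_size_cat // => -[-> -> ->].
    by rewrite catA eb' size_base size_rcons.
  case dx: (dec x) => [a|j|j|j].
  - case: eqP => // ea; case=> // -[e1 e2 e3]; subst m' adv act => /push [-> -> ->].
    case: r ea hr => // a' r [ea] _ /=; subst a'.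
    exists (main_sem q' (rcons v x) r); first by apply: mean_main; rewrite size_rcons; right.
    case=> u [w [hu hw ->]]; exists (x :: u), (dec x :: w); split.
    + exact: nfa_sym e hu.
    + by apply: expand_sym => //; rewrite dx.
    + by rewrite dx.
  - case=> // -[<- <- <-] /push [-> -> ->] /=.
    exists (main_sem q' (rcons v x) r); first by apply: mean_main; rewrite size_rcons; right.
    case=> u [w [hu hw ->]]; exists (x :: u), (dec x :: w); split.
    + exact: nfa_sym e hu.
    + by apply: expand_sym => //; rewrite dx.
    + by rewrite dx.
  - case=> // -[<- <- <-] /push [-> -> ->] /=.
    exists (main_sem q' (rcons v x) r); first by apply: mean_main; rewrite size_rcons; right.
    case=> u [w [hu hw ->]]; exists (x :: u), (dec x :: w); split.
    + exact: nfa_sym e hu.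
    + by apply: expand_sym => //; rewrite dx.
    + by rewrite dx.
  - case=> // -[<- <- <-] /push [-> -> ->] /=.
    exists (seek_sem j v (main_sem q' (rcons v x)) r).
      by apply: mean_num dx _; right.
    case=> w1 [r' [hv -> [u [w [hu hw ->]]]]].
    exists (x :: u), (map (@SL Sigma) w1 ++ w); split.
    + exact: nfa_sym e hu.
    + exact: expand_num dx hv hw.
    + by rewrite gh_cat gh_SL.
move: hin ha; rewrite -[(size v).+2]addn0 nth_base /=.
case=> // -[<- <- <-] /act_leftE [-> -> ->] /=; rewrite addn0.
by exists (main_sem q v r) => //; apply: mean_main; left.
Qed.

Lemma meaning_num_step q v y j r p c' :
  dec y = SNum j -> p = (size v).+2 \/ p = (size v).+3 ->
  step (Walk q None, r, base (rcons v y) ++ [:: CTop], [::], p) c' ->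
  exists2 P, meaning c' P & P -> seek_sem j v (main_sem q (rcons v y)) r.
Proof.
move=> dy [] -> /stepE [m' [adv [act [s' [sv' [p' [-> hin hp _ ha]]]]]]].
  move: hin ha hp; rewrite base_rcons -[(size v).+2]addn0 nth_base /= dy.
  case=> // -[<- <- <-] /act_createE; rewrite addn0 take_base drop_base => -[-> -> ->] _ /=.
  exists (seek_sem (lab y) v (main_sem q (rcons v y)) r); last by rewrite /lab dy.
  (* The search starts at the top of the substack, to the right of all of [v], so no cell of [v] has
     been passed yet. *)
  apply: (@mean_seek q y v (CMain y)).
  by rewrite size_cat size_base drop_oversize // leqW // leq_addr.
move: hin ha; rewrite base_rcons -[(size v).+3]addn1 nth_base /=.
case=> // -[<- <- <-] /act_leftE [-> -> ->] /=; rewrite addn1 -base_rcons.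
by exists (seek_sem j v (main_sem q (rcons v y)) r) => //; apply: mean_num dy _; left.
Qed.

Lemma meaning_walk_step q x a b k r c' :
  step (Walk q (Some x), r, base (a ++ b) ++ tail k, saves k, (size a).+2) c' ->
  exists2 P, meaning c' P & P -> walk_sem x a b (return_sem k (a ++ b) q) r.
Proof.
case/stepE=> [m' [adv [act [s' [sv' [p' [-> hin hp hr ha]]]]]]].
move: hin ha; rewrite base_cat -catA -[(size a).+2]addn0 nth_base addn0.
case: b hp => //= y b hp.
have right_sem r' P : meaning (Walk q (Some x), r', base (rcons a y ++ b) ++ tail k, saves k,
      (size (rcons a y)).+2) P ->
    meaning (Walk q (Some x), r', base a ++ cg y :: map cg b ++ tail k, saves k, (size a).+3) P.
  by rewrite cat_rcons base_cat -catA size_rcons.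
case dy: (dec y) => [e|i|i|i].
- case: eqP => // er; case=> // -[e1 e2 e3]; subst m' adv act => /act_rightE [-> -> ->].
  case: r er hr => // e' r [->] _ /=.
  eexists; first exact/right_sem/mean_walk.
  case=> t [c [p [w [r' [-> [dc nc] hw -> hP]]]]].
  exists (y :: t), c, p, (dec y :: w), r'; split=> //=; last by rewrite -cat_rcons.
  + by rewrite dy.
  + by apply: expand_sym => //; rewrite dy.
  + by rewrite dy.
- case=> // -[<- <- <-] /act_rightE [-> -> ->] /=.
  eexists; first exact/right_sem/mean_walk.
  case=> t [c [p [w [r' [-> [dc nc] hw -> hP]]]]].
  exists (y :: t), c, p, (dec y :: w), r'; split=> //=; last by rewrite -cat_rcons.
  + by rewrite dy.
  + by apply: expand_sym => //; rewrite dy.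
  + by rewrite dy.
(* A closing bracket with the label of [x] ends the capture, and the unread part [t] is empty. *)
- case: eqP => [ei|ni]; case=> // -[<- <- <-].
    move=> /act_stayE [-> -> ->] /=; exists (return_sem k (a ++ y :: b) q r).
      by have := mean_ret q (a ++ y :: b) k r (size a).+2; rewrite base_cat -catA.
    move=> hP; exists [::], y, b, [::], r; split=> //; last exact: expand_nil.
    by rewrite dy ei.
  move=> /act_rightE [-> -> ->] /=.
  eexists; first exact/right_sem/mean_walk.
  case=> t [c [p [w [r' [-> [dc nc] hw -> hP]]]]].
  exists (y :: t), c, p, (dec y :: w), r'; split=> //=; last by rewrite -cat_rcons.
  + by rewrite dy /= (introF eqP ni).
  + by apply: expand_sym => //; rewrite dy.
  + by rewrite dy.
- case=> // -[<- <- <-] /act_createE; rewrite take_base drop_base => -[-> -> ->] /=.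
  (* A number opens a call whose continuation is the rest [b] of the present reading. *)
  exists (seek_sem (lab y) a (return_sem (CWalk x y b k) a q) r).
    apply: (@mean_seek q y a (CWalk x y b k)).
    by rewrite size_cat size_base drop_oversize // leqW // leq_addr.
  case=> w1 [r1 [hv -> [t [c [p [w [r' [-> [dc nc] hw -> hP]]]]]]]].
  exists (y :: t), c, p, (map (@SL Sigma) w1 ++ w), r'; split=> //=.
  + by rewrite dy.
  + by apply: expand_num hw; rewrite ?dy //; move: hv; rewrite /lab dy.
  + by rewrite gh_cat gh_SL catA.
  + by rewrite -cat_rcons.
Qed.

(** Because of the two bottom cells, [drop p.-1 v] is the part of [v] strictly to the right of the
    pointer. It contains no opening bracket of the label, so the first one met is the nearest. *)
Lemma meaning_seek_step q x v k r p c' :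
  ~~ has (opens (lab x)) (drop p.-1 v) ->
  step (Seek q x, r, base v ++ tail k, saves k, p) c' ->
  exists2 P, meaning c' P & P -> seek_sem (lab x) v (return_sem k v q) r.
Proof.
move=> no /stepE [m' [adv [act [s' [sv' [p' [-> hin hp _ ha]]]]]]].
have left : (m', adv, act) = (Seek q x, false, ALeft) -> ~~ has (opens (lab x)) (drop p.-2 v) ->
    exists2 P, meaning (m', if adv then behead r else r, s', sv', p') P &
      P -> seek_sem (lab x) v (return_sem k v q) r.
  move=> [e1 e2 e3] no'; subst m' adv act; case/act_leftE: ha => -> -> -> /=.
  by exists (seek_sem (lab x) v (return_sem k v q) r) => //; apply: mean_seek.
case/base_position: (hp) => [ep|ep|[a [y [b [ev ep]]]]|[m hm ep]]; subst p.
- move: hin; rewrite nth_base0; case=> // -[e1 e2 e3]; subst m' adv act;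
  case/act_rightE: ha => -> -> -> /=.
  exists (return_sem k v q r); first exact: mean_ret.
  move=> hP; exists [::], r; split=> //; apply: value_none.
  by move: no; rewrite /= drop0.
- by move: hin; rewrite nth_base1; case=> // -[e1 e2 e3]; apply: left; rewrite ?e1 ?e2 ?e3.
- subst v; move: hin; rewrite base_cat -catA -[(size a).+2]addn0 nth_base /=.
  have no' : ~~ has (opens (lab x)) b.
    by move: no; rewrite /= -cat_rcons -(size_rcons a y) drop_size_cat.
  case: ifP => [oy|ny]; case=> // -[e1 e2 e3]; last first.
    apply: left; rewrite ?e1 ?e2 ?e3 //= drop_size_cat //=.
    by rewrite ny.
  subst m' adv act; case/act_rightE: ha => -> -> -> /=.
  have -> : (size a).+3 = (size (rcons a y)).+2 by rewrite size_rcons.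
  rewrite -cat_rcons; eexists; first exact: mean_walk.
  (* The invariant makes [y] the nearest opening bracket, and [walk_sem] supplies its closing
     bracket. *)
  case=> t [c [p [w [r' [eb [dc nc] hw -> hP]]]]].
  exists (gh w), r'; split=> //; rewrite eb cat_rcons; apply: value_cap => //.
  + by case: (dec y) oy => //= i /eqP ->.
  + by rewrite -eb.
- move: hin; rewrite nth_base => hin.
  have no' : ~~ has (opens (lab x)) (drop ((size v).+2 + m).-2 v).
    by rewrite !addSn /= drop_oversize // leq_addr.
  by apply: left => //; clear -hm hin; case: m hm hin => [|[|[|]]] //= _ [].
Qed.

Lemma meaning_ret_step q v k r p c' :
  step (Ret q, r, base v ++ tail k, saves k, p) c' ->
  exists2 P, meaning c' P & P -> return_sem k v q r.
Proof.
move=> /stepE [m' [adv [act [s' [sv' [p' [-> hin hp _ ha]]]]]]].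
exists (return_sem k v q r) => //.
have right : (m', adv, act) = (Ret q, false, ARight) ->
    meaning (m', if adv then behead r else r, s', sv', p') (return_sem k v q r).
  move=> [e1 e2 e3]; subst m' adv act; case/act_rightE: ha => -> -> -> /=.
  exact: mean_ret.
case/base_position: (hp) => [ep|ep|[a [y [b [ev ep]]]]|[m hm ep]]; subst p.
- by move: hin; rewrite nth_base0; case=> // e; apply: right.
- by move: hin; rewrite nth_base1; case=> // e; apply: right.
- subst v; move: hin; rewrite base_cat -catA -[(size a).+2]addn0 nth_base /=.
  by case=> // e; apply: right.
- move: hin ha; rewrite nth_base; case: m hm {hp} => [|[|[|m]]] //= _.
  + by case=> // e _; apply: right.
  + by case=> // e _; apply: right.
  + case=> // -[<- <- <-] /act_leftE [-> -> ->] /=.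
    by rewrite addn2; apply: mean_pop.
Qed.

(** Here the finite control recovers from the stack which reading is to be resumed. *)
Lemma meaning_pop_step q v k r c' :
  step (Pop q, r, base v ++ tail k, saves k, (size v).+3) c' ->
  exists2 P, meaning c' P & P -> return_sem k v q r.
Proof.
move=> /stepE [m' [adv [act [s' [sv' [p' [-> hin hp _ ha]]]]]]].
exists (return_sem k v q r) => //.
have e3 : (size v).+3 = (size v).+2 + 1 by rewrite addn1.
move: hin ha; rewrite e3 nth_base /= -e3; case=> // -[<- <- <-] /act_replE.
have -> : take (size v).+3 (base v ++ tail k) = base v ++ [:: CCent].
  by rewrite -[tail k]/([:: CCent] ++ behead (tail k))
    catA take_size_cat // size_cat size_base addn1.
rewrite /= cats0 size_cat size_base addn1 -catA => -[-> -> ->].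
by apply: mean_destroy; right.
Qed.

Lemma meaning_destroy_step q v k r p c' :
  p = (size v).+2 \/ p = (size v).+3 ->
  step (Destroy q (saved k), r, base v ++ [:: CCent; CTop], saves k, p) c' ->
  exists2 P, meaning c' P & P -> return_sem k v q r.
Proof.
move=> hp /stepE [m' [adv [act [s' [sv' [p' [-> hin _ _ ha]]]]]]].
exists (return_sem k v q r) => //.
case: hp hin ha => ->.
  rewrite -[(size v).+2]addn0 nth_base /=; case=> // -[<- <- <-].
  case: k => [y|x y b k] /act_destroyE [-> -> ->] /=; rewrite size_base.
    exact: (@mean_resume q v (CMain y)).
  exact: (@mean_resume q v (CWalk x y b k)).
have e3 : (size v).+3 = (size v).+2 + 1 by rewrite addn1.
rewrite e3 nth_base /= -e3; case=> // -[<- <- <-] /act_leftE [-> -> ->] /=.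
by apply: mean_destroy; left.
Qed.

Lemma meaning_resume_step q v k r c' :
  step (Resume q (saved k), r, base v ++ suffix k, behead (saves k), (size v).+2) c' ->
  exists2 P, meaning c' P & P -> return_sem k v q r.
Proof.
case/stepE=> [m' [adv [act [s' [sv' [p' [-> hin _ _ ha]]]]]]].
exists (return_sem k v q r) => //.
case: k hin ha => [y|x y b k] /=; case=> // -[<- <- <-].
  move=> /act_stayE [-> -> ->] /=; rewrite -base_rcons.
  by apply: mean_main; rewrite size_rcons; left.
move=> /act_rightE [-> -> ->] /=; rewrite -(size_rcons v y) -base_rcons catA -base_cat.
exact: mean_walk.
Qed.

Lemma meaning_step c c' P :
  meaning c P -> step c c' -> exists2 P', meaning c' P' & P' -> P.
Proof.
case=> [q v r p hp|q v y j r p hy hp|q x a b k r|q x v k r p no|q v k r p|q v k r|q v k r p hp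
  |q v k r];
  [exact: meaning_main_step|exact: meaning_num_step|exact: meaning_walk_step
  |exact: meaning_seek_step|exact: meaning_ret_step|exact: meaning_pop_step
  |exact: meaning_destroy_step|exact: meaning_resume_step].
Qed.

(** Only [Main] states are final. There, with no input left, the meaning holds with an empty guess,
    and it is pulled back along the run. *)
Lemma machine_sound w : nsa_accepts machine w -> main_sem q0 [::] w.
Proof.
case=> q [s [sv [p [H hF]]]].
have hm : meaning (Main q0, w, [:: CBot; CG (inr None); CTop], [::], 1) (main_sem q0 [::] w).
  by rewrite base_nil; apply: mean_main; left.
suff HS c c' : star step c c' -> forall P, meaning c P ->
    nsa_final c'.1.1.1.1 -> c'.1.1.1.2 = [::] -> P by exact: HS H _ hm hF erefl.
elim=> {c c'} [c|c c1 c2 e _ IH] P hc; last first.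
  have [P' hc1 PP'] := meaning_step hc e; move=> hf hr.
  exact: PP' (IH _ hc1 hf hr).
case: hc => //= q1 v r p1 _ hf ->.
exists [::], [::]; split=> //; [exact: nfa_nil|exact: expand_nil].
Qed.

(** * Completeness: construction of accepting runs *)

Lemma silent_step m r s sv p m' act s' sv' p' :
  List.In (m', false, act) (delta m (ohead r) (nth CBot s p)) ->
  p < size s -> act_sem act s sv p s' sv' p' -> step (m, r, s, sv, p) (m', r, s', sv', p').
Proof. by move=> h hp ha; apply: (stepI h hp _ ha). Qed.

Lemma reading_step m a r s sv p m' act s' sv' p' :
  List.In (m', true, act) (delta m (Some a) (nth CBot s p)) ->
  p < size s -> act_sem act s sv p s' sv' p' ->
  step (m, a :: r, s, sv, p) (m', r, s', sv', p').
Proof. by move=> h hp ha; apply: (@stepI m (a :: r) _ _ _ _ true _ _ _ _ h hp _ ha). Qed.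

Lemma size_base_tail v k : size (base v ++ tail k) = (size v).+2 + 3.
Proof. by rewrite size_cat size_base. Qed.

Lemma seek_down n p v k q x r :
  n <= p -> p < size (base v ++ tail k) -> ~~ has (opens (lab x)) (drop n.-1 v) ->
  star step (Seek q x, r, base v ++ tail k, saves k, p)
            (Seek q x, r, base v ++ tail k, saves k, n).
Proof.
elim: p => [|p IH]; first by rewrite leqn0 => /eqP -> *; apply: star_refl.
rewrite leq_eqVlt => /orP[/eqP -> *|np hp no]; first exact: star_refl.
apply: star_step (IH np (ltnW hp) no); apply: (@silent_step _ _ _ _ _ _ ALeft) => //;
  last exact: as_left.
case/base_position: (hp) => [//|[ep]|[a [y [b [ev [ep]]]]]|[m hm [ep]]].
- by rewrite ep nth_base1; left.
- have hy : ~~ isOpen (lab x) (dec y).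
    have hn : n.-1 <= size a by case: (n) np => //= n' hn'; rewrite -ltnS -ep.
    move: no; rewrite ev -(cat_take_drop n.-1 a) -catA drop_size_cat.
      by rewrite has_cat negb_or /= negb_or => /and3P[].
    by rewrite size_take; case: ltngtP hn.
  rewrite ev base_cat -catA ep -[(size a).+2]addn0 nth_base /=.
  by rewrite (negbTE hy); left.
- by rewrite ep -!addSn nth_base; case: m hm {ep} => [|[|[|]]] //= _; left.
Qed.

(** The position [(size v).+4] is that of [CTop], above [CCent] and the remembered label. *)
Lemma ret_up p v k q r :
  p <= (size v).+4 ->
  star step (Ret q, r, base v ++ tail k, saves k, p)
            (Ret q, r, base v ++ tail k, saves k, (size v).+4).
Proof.
move=> /subnKC; move: (_ - p) => n; elim: n p => [|n IH] p hp.
  by rewrite -hp addn0; apply: star_refl.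
have lep : p.+1 < size (base v ++ tail k).
  by rewrite size_base_tail addn3 ltnS -hp addnS ltnS leq_addr.
apply: star_step (IH p.+1 _); last by rewrite addSnnS.
apply: (@silent_step _ _ _ _ _ _ ARight); [|exact: ltnW|exact: as_right].
case/base_position: (ltnW lep) => [->|->|[a [y [b [-> ->]]]]|[m hm ep]].
- by rewrite nth_base0; left.
- by rewrite nth_base1; left.
- by rewrite base_cat -catA -[(size a).+2]addn0 nth_base; left.
- have /addnI hmn : (size v).+2 + (m + n.+1) = (size v).+2 + 2 by rewrite addnA -ep hp addn2.
  by rewrite ep nth_base; case: m hm hmn {ep} => [|[|[|]]] //= _ _; left.
Qed.

(** The exit of a call: up to [CTop], the label is popped into the state, and the empty substack is
    destroyed at [CCent]. *)
Lemma resume_run p v k q r :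
  p <= (size v).+4 ->
  star step (Ret q, r, base v ++ tail k, saves k, p)
            (Resume q (saved k), r, base v ++ suffix k, behead (saves k), (size v).+2).
Proof.
move=> hp; apply: star_trans (ret_up k q r hp) _.
have e3 : (size v).+3 = (size v).+2 + 1 by rewrite addn1.
have e4 : (size v).+4 = (size v).+2 + 2 by rewrite addn2.
apply: (@star_step _ _ _ (Pop q, r, base v ++ tail k, saves k, (size v).+3)).
  apply: (@silent_step _ _ _ _ _ _ ALeft); last exact: as_left.
    by rewrite e4 nth_base; left.
  by rewrite size_base_tail addn3.
apply: (@star_step _ _ _
  (Destroy q (saved k), r, base v ++ [:: CCent; CTop], saves k, (size v).+3)).
  apply: (@silent_step _ _ _ _ _ _ (ARepl [::])).
  - by rewrite e3 nth_base; left.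
  - by rewrite size_base_tail addn3.
  - have et : take (size v).+3 (base v ++ tail k) = base v ++ [:: CCent].
      by rewrite -[tail k]/([:: CCent] ++ behead (tail k))
        catA take_size_cat // size_cat size_base addn1.
    have := @as_repl gam [::] (base v ++ tail k) (saves k) (size v).+3.
    rewrite size_base_tail addn3 et e3 nth_base /= cats0 size_cat size_base -catA -e3.
    by apply.
apply: (@star_step _ _ _
  (Destroy q (saved k), r, base v ++ [:: CCent; CTop], saves k, (size v).+2)).
  apply: (@silent_step _ _ _ _ _ _ ALeft); last exact: as_left.
    by rewrite e3 nth_base; left.
  by rewrite size_cat size_base addn2.
apply: star_step (star_refl _ _); apply: (@silent_step _ _ _ _ _ _ ADestroy).
- by rewrite -[(size v).+2]addn0 nth_base; left.
- by rewrite size_cat size_base addn2.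
- have -> : saves k = suffix k :: behead (saves k) by case: (k).
  by rewrite -(size_base v); apply: as_destroy.
Qed.

(** Quantified over all contexts and remaining inputs, as is [seek_run], since the induction uses
    these runs inside nested calls. *)
Definition walk_run a t (w : seq (sym Sigma)) := forall b k q r x,
  ~~ has (closes (lab x)) t ->
  star step (Walk q (Some x), gh w ++ r, base (a ++ t ++ b) ++ tail k, saves k, (size a).+2)
            (Walk q (Some x), r, base (a ++ t ++ b) ++ tail k, saves k, (size (a ++ t)).+2).

Definition seek_run v j w := forall k q r x, lab x = j ->
  star step (Seek q x, w ++ r, base v ++ tail k, saves k, (size v).+4)
            (Resume q (saved k), r, base v ++ suffix k, behead (saves k), (size v).+2).

(** The derivation tree of [expand] and [value] is the tree of nested calls, so mutual induction on
    it builds the run. *)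
Lemma walk_seek_runs :
  (forall a t w, expand dec a t w -> walk_run a t w) /\
  (forall v j w, value dec v j w -> seek_run v j w).
Proof.
apply: expand_value_ind => [p|p y u w ny _ IH|p y j u v w dy _ IHv _ IH|p j np
  |p1 o t c p3 j w ho hc no nc _ IH].
- by move=> b k q r x _; rewrite cats0; apply: star_refl.
- move=> b k q r x /=; rewrite negb_or => /andP[nyx nu].
  have := IH b k q r x nu; rewrite !cat_rcons size_rcons; apply: star_step.
  have hp : (size p).+3 < size (base (p ++ y :: u ++ b) ++ tail k).
    by rewrite size_base_tail size_cat /=; lia.
  case ey: (dec y) ny nyx => [e|i|i|//] _ nyx.
  + apply: (@reading_step _ _ _ _ _ _ _ ARight); [|exact: ltnW|exact: as_right].
    by rewrite base_cat -catA -[(size p).+2]addn0 nth_base /= ey eqxx; left.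
  + apply: (@silent_step _ _ _ _ _ _ ARight); [|exact: ltnW|exact: as_right].
    by rewrite base_cat -catA -[(size p).+2]addn0 nth_base /= ey; left.
  + apply: (@silent_step _ _ _ _ _ _ ARight); [|exact: ltnW|exact: as_right].
    rewrite base_cat -catA -[(size p).+2]addn0 nth_base /= ey.
    by move: nyx => /= /negbTE ->; left.
- move=> b k q r x /=; rewrite negb_or gh_cat gh_SL -catA => /andP[_ nu].
  have := IH b k q r x nu; rewrite !cat_rcons size_rcons => run.
  have hp : (size p).+3 < size (base (p ++ y :: u ++ b) ++ tail k).
    by rewrite size_base_tail size_cat /=; lia.
  have eb : base (p ++ y :: u ++ b) ++ tail k = base p ++ suffix (CWalk x y (u ++ b) k).
    by rewrite base_cat -catA.
  have hy : lab y = j by rewrite /lab dy.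
  (* The call is made in the context that remembers [x] and the rest [u ++ b] of the stack. *)
  apply: star_step (star_trans (IHv (CWalk x y (u ++ b) k) q (gh w ++ r) y hy) _).
    apply: (@silent_step _ _ _ _ _ _ (ACreate [:: inr (Some x)])); [|exact: ltnW|].
      by rewrite base_cat -catA -[(size p).+2]addn0 nth_base /= dy; left.
    have := @as_create gam [:: inr (Some x)] (base p ++ suffix (CWalk x y (u ++ b) k))
      (saves k) (size p).+2 isT.
    by rewrite take_base drop_base size_cat size_base addn2 eb.
  apply: star_step run; rewrite eb /=.
  apply: (@silent_step _ _ _ _ _ _ ARight); [by left| |apply: as_right];
    by rewrite eb in hp; first [exact: ltnW|exact: hp].
- move=> k q r x hx; have hs := size_base_tail p k.
  (* Without a capture the search goes down to [CBot], at position 0. *)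
  apply: star_trans (seek_down (n := 0) _ _ _ _ _) _; rewrite ?hs ?addn3 ?drop0 ?hx //.
  apply: star_step (resume_run k q r (isT : 1 <= (size p).+4)).
  by apply: (@silent_step _ _ _ _ _ _ ARight); [left|rewrite hs|apply: as_right; rewrite hs].
- move=> k q r x hx; set v := p1 ++ _; have hs := size_base_tail v k.
  have sv : size v = size p1 + (size t + (size p3).+1).+1 by rewrite /v !size_cat /= size_cat.
  (* The search stops at [(size p1).+2], the position of the opening bracket [o]. *)
  apply: star_trans (seek_down (n := (size p1).+2) _ _ _ _ _) _.
  + by rewrite sv; lia.
  + by rewrite hs addn3.
  + by rewrite /= hx /v -cat_rcons -(size_rcons p1 o) drop_size_cat.
  have ev : v = rcons p1 o ++ t ++ c :: p3 by rewrite cat_rcons.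
  have nc' : ~~ has (closes (lab x)) t by rewrite hx.
  have := IH (c :: p3) k q r x nc'; rewrite -ev => run.
  apply: star_step (star_trans run _).
    apply: (@silent_step _ _ _ _ _ _ ARight).
    + rewrite /v base_cat -catA -[(size p1).+2]addn0 nth_base /=.
      by rewrite ho /= hx eqxx; left.
    + by rewrite hs sv; lia.
    + rewrite size_rcons; apply: as_right.
      by rewrite hs sv; lia.
  apply: star_step (resume_run k q r (_ : (size (rcons p1 o ++ t)).+2 <= _)); last first.
    by rewrite ev catA [size (_ ++ c :: _)]size_cat /=; lia.
  apply: (@silent_step _ _ _ _ _ _ AStay); last exact: as_stay.
    rewrite ev catA base_cat -catA -[(size (rcons p1 o ++ t)).+2]addn0 nth_base /=.
    by rewrite hc hx eqxx; left.
  by rewrite hs sv !size_cat size_rcons; lia.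
Qed.

(** The machine guesses [u] along its accepting path, on top of the part [v] already pushed; each
    number is evaluated as soon as it is pushed. *)
Lemma main_run q u v w :
  nfa_lang E F q u -> expand dec v u w ->
  exists q' s sv p, star step (Main q, gh w, base v ++ [:: CTop], [::], (size v).+1)
                              (Main q', [::], s, sv, p) /\ F q'.
Proof.
move=> H; elim: H v w => {q u} [q Fq|q q' u e _ IH|q y q' u e _ IH] v w.
- move/expand_nilI => ->; exists q, (base v ++ [:: CTop]), [::], (size v).+1.
  by split=> //; apply: star_refl.
- move=> /IH [qf [s [sv [p [run Fqf]]]]]; exists qf, s, sv, p; split=> //.
  apply: star_step run; apply: (@silent_step _ _ _ _ _ _ AStay); last exact: as_stay.
    have [b [z [eb sb]]] := base_last v.
    rewrite eb -sb cat_rcons nth_cat ltnn subnn /= In_flatten_enum.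
    by exists (None, q'); rewrite /= e; left.
  by rewrite size_cat size_base addn1 ltnS leqW.
- have [b [z [eb sb]]] := base_last v.
  have hp : (size v).+1 < size (base v ++ [:: CTop]) by rewrite size_cat size_base addn1 ltnS.
  have hn : nth CBot (base v ++ [:: CTop]) (size v).+1 = CG z.
    by rewrite eb -sb cat_rcons nth_cat ltnn subnn.
  have push : act_sem (ARepl [:: z; inl y]) (base v ++ [:: CTop]) [::] (size v).+1
      (base (rcons v y) ++ [:: CTop]) [::] (size v).+3.
    have et : take (size v).+1 (base v ++ [:: CTop]) = b.
      by rewrite eb cat_rcons -sb take_size_cat.
    have eb' : b ++ map (@CG gam) [:: z; inl y] = base (rcons v y).
      by rewrite -cat_rcons -eb -cats1 base_cat.
    have := @as_repl gam [:: z; inl y] (base v ++ [:: CTop]) [::] (size v).+1.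
    rewrite hn et catA eb' !size_cat !size_base size_rcons addn1.
    by apply.
  (* The move off [CTop] does not depend on the input, so it suffices to check it at [None]. *)
  have top m : List.In (m, false, ALeft) (delta m None CTop) -> forall r,
      step (m, r, base (rcons v y) ++ [:: CTop], [::], (size v).+3)
           (m, r, base (rcons v y) ++ [:: CTop], [::], (size v).+2).
    move=> hm r; apply: (@silent_step _ _ _ _ _ _ ALeft); last exact: as_left.
      have -> : (size v).+3 = (size (rcons v y)).+2 + 0 by rewrite size_rcons addn0.
      by rewrite nth_base /=; case: m hm => //= q1 [].
    by rewrite size_cat size_base size_rcons addn1.
  case ey: (isNum (dec y)).
    case dy: (dec y) ey => [||| j] // _ /(expand_numI dy) [r [w' [hr -> hw]]].
    have [qf [s [sv [p [run Fqf]]]]] := IH _ _ hw; exists qf, s, sv, p; split=> //.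
    apply: (@star_step _ _ _ (Walk q' None, gh (map (@SL Sigma) r ++ w'),
      base (rcons v y) ++ [:: CTop], [::], (size v).+3)).
      apply: silent_step hp push; rewrite hn /= In_flatten_enum.
      by exists (Some y, q'); rewrite /= e dy; left.
    apply: star_step (top _ _ _) _; first by left.
    rewrite gh_cat gh_SL base_rcons.
    have hl : lab y = j by rewrite /lab dy.
    apply: star_step (star_trans (walk_seek_runs.2 _ _ _ hr (CMain y) q' (gh w') y hl) _).
      apply: (@silent_step _ _ _ _ _ _ (ACreate [:: inr None])).
      + by rewrite -[(size v).+2]addn0 nth_base /= dy; left.
      + by rewrite size_cat size_base addn2.
      + have := @as_create gam [:: inr None] (base v ++ [:: cg y; CTop]) [::] (size v).+2 isT.
        by rewrite take_base drop_base size_cat size_base addn2.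
    apply: star_step run; rewrite size_rcons base_rcons.
    by apply: (@silent_step _ _ _ _ _ _ AStay);
      [left|rewrite size_cat size_base addn2|apply: as_stay].
  move/negbT: ey => ny /(expand_symI ny) [w' -> hw].
  have [qf [s [sv [p [run Fqf]]]]] := IH _ _ hw; exists qf, s, sv, p; split=> //.
  have back : step (Main q', gh w', base (rcons v y) ++ [:: CTop], [::], (size v).+3)
      (Main q', gh w', base (rcons v y) ++ [:: CTop], [::], (size (rcons v y)).+1).
    by rewrite size_rcons; apply: top; left.
  apply: star_step (star_step back run).
  case dy: (dec y) ny => [a|i|i|//] _.
  + apply: reading_step hp push; rewrite hn /= In_flatten_enum.
    by exists (Some y, q'); rewrite /= e dy /= eqxx; left.
  + apply: silent_step hp push; rewrite hn /= In_flatten_enum.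
    by exists (Some y, q'); rewrite /= e dy; left.
  + apply: silent_step hp push; rewrite hn /= In_flatten_enum.
    by exists (Some y, q'); rewrite /= e dy; left.
Qed.

Lemma machineP w : nsa_accepts machine w <-> main_sem q0 [::] w.
Proof.
split; first exact: machine_sound.
case=> u [v [hu hv ->]]; have [q [s [sv [p [run Fq]]]]] := main_run hu hv.
by exists (Main q), s, sv, p; split=> //; move: run; rewrite -base_nil.
Qed.

End Machine.

(** * The automaton of a rewb *)

Theorem theorem1 (Sigma : finType) (k : nat) (alpha : rewb Sigma) :
  in_REWB k alpha ->
  exists A : nsa Sigma, forall w : seq Sigma, nsa_accepts A w <-> rewb_lang alpha w.
Proof.
move=> hk; have [Q [E [F [q0 nfaP]]]] := rx_finite_nfa (rx_of k alpha).
exists (machine (@tok_sym Sigma k) E F q0) => w; rewrite machineP; split.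
- case=> u [v [/nfaP hu hv ->]]; exists (map (@tok_sym Sigma k) u).
  split; first by apply/(rx_ofP _ hk); exists u.
  by apply: (expand_deref (w := [::]) hv); apply: expand_nil.
- case=> v [/(rx_ofP _ hk) [u /nfaP hu ->] hd].
  have [v' hv ->] := deref_expand (w := [::]) (expand_nil _ _) hd.
  by exists u, v'.
Qed.
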